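(* Let $\mathcal{S}_Z=((X,d),(f_i)_{i\in I},(\rho_i)_{i\in I})$ be an orbital fuzzy iterated function system, with fuzzy Hutchinson–Barnsley operator $Z$. Then $Z$ is a weakly Picard operator on $(\mathcal{F}_{\mathcal{S}}^{\ast},d_\infty)$, i.e. $Z$ maps $\mathcal{F}_{\mathcal{S}}^{\ast}$ into itself and for every $u\in\mathcal{F}_{\mathcal{S}}^{\ast}$ the sequence $(Z^{n}(u))_{n\in\mathbb{N}}$ converges with respect to $d_\infty$ to an element of $\mathcal{F}_{\mathcal{S}}^{\ast}$ which is a fixed point of $Z$.
   Context: **Orbital contractive iterated function system.** Let $(X,d)$ be a complete metric space and $(f_i)_{i\in I}$ a nonempty finite family of continuous functions $f_i:X\to X$. For a finite word $\omega=\omega_1\cdots\omega_n$ with letters in $I$ put $f_\omega=f_{\omega_1}\circ\cdots\circ f_{\omega_n}$, with $f_\lambda=\mathrm{id}_X$ for the empty word $\lambda$. The orbit of $x\in X$ is $\mathcal{O}(x)=\{f_\omega(x): \omega \text{ a finite (possibly empty) word over } I\}$; $\overline{\mathcal{O}(x)}$ is its closure. $\mathcal{S}=((X,d),(f_i)_{i\in I})$ is an orbital contractive iterated function system if there is $C\in[0,1)$ such that $d(f_i(y),f_i(z))\le C\,d(y,z)$ for all $x\in X$, $i\in I$ and $y,z\in\mathcal{O}(x)$. **Fuzzy sets.** A fuzzy subset of $X$ is a function $u:X\to[0,1]$. For $\alpha\in(0,1]$, $[u]^\alpha=\{x\in X: u(x)\ge\alpha\}$, and $[u]^0=\operatorname{supp}(u)=\overline{\{x\in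 X:u(x)>0\}}$. $u$ is normal if $u(x)=1$ for some $x\in X$, compactly supported if $[u]^0$ is compact, and usc (upper semicontinuous) if $\{x:u(x)\ge\alpha\}$ is closed for each $\alpha\in\mathbb{R}$. $\mathcal{F}_X^{\ast\ast}$ is the set of normal compactly supported fuzzy subsets of $X$; $\mathcal{F}_X^{\ast}$ is the set of usc elements of $\mathcal{F}_X^{\ast\ast}$. For a map $T:X\to X$ and a fuzzy set $u$, $T(u)(y)=\sup_{T(x)=y}u(x)$ if $y\in T(X)$ and $T(u)(y)=0$ otherwise. **Metric.** For nonempty bounded $A,B\subset X$, $h(A,B)=\max\{\sup_{x\in A}\inf_{y\in B}d(x,y),\ \sup_{y\in B}\inf_{x\in A}d(x,y)\}$. For $u,v\in\mathcal{F}_X^{\ast\ast}$, $d_\infty(u,v)=\sup_{\alpha\in[0,1]}h([u]^\alpha,[v]^\alpha)$; it is a semimetric on $\mathcal{F}_X^{\ast\ast}$ and a metric on $\mathcal{F}_X^{\ast}$. **Admissible grey level maps.** $(\rho_i)_{i\in I}$, $\rho_i:[0,1]\to[0,1]$, is admissible if every $\rho_i$ is nonzero, nondecreasing and right continuous, $\rho_i(0)=0$ for all $i$, and $\rho_i(1)=1$ for some $i\in I$. **Orbital fuzzy iterated function system.** $\mathcal{S}_Z=((X,d),(f_i)_{i\in I},(\rho_i)_{i\in I})$, where $((X,d),(f_i)_{i\in I})$ is an orbital contractive iterated function system and $(\rho_i)_{i\in I}$ is admissible. Its fuzzy Hutchinson–Barnsley operator $Z:\mathcal{F}_X^{\ast\ast}\to\mathcal{F}_X^{\ast\ast}$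 is $Z(u)(x)=\max_{i\in I}\rho_i\big(f_i(u)(x)\big)$. **The sets $\mathcal{F}_{\mathcal{S}}^{\ast\ast}$, $\mathcal{F}_{\mathcal{S}}^{\ast}$.** $\mathcal{F}_{\mathcal{S}}^{\ast\ast}$ is the set of $u\in\mathcal{F}_X^{\ast\ast}$ such that for every $x\in X$ with $u(x)>0$ there exist $w\in X$ and $y\in\overline{\mathcal{O}(w)}$ with $x\in\overline{\mathcal{O}(w)}$ and $u(y)=1$. $\mathcal{F}_{\mathcal{S}}^{\ast}$ is the set of usc elements of $\mathcal{F}_{\mathcal{S}}^{\ast\ast}$. *)

(* Defs.v *)
From mathcomp Require Import all_boot all_order all_algebra.
From mathcomp Require Import all_classical all_reals all_analysis.

Set Implicit Arguments.
Unset Strict Implicit.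
Unset Printing Implicit Defensive.

Import Order.TTheory GRing.Theory Num.Theory.
Import numFieldNormedType.Exports.

Local Open Scope classical_set_scope.
Local Open Scope ring_scope.

(* The axiom of completeType, without the distinguished point that completeType
   (through isPointed) requires of its carrier. *)
Definition complete_space (X : uniformType) : Prop :=
  forall F : set_system X, ProperFilter F -> cauchy F -> exists x : X, F --> x.

Section ifs.
Context {R : realType} {X : metricType R} {I : finType}.
Implicit Types (f : I -> X -> X) (x y z w : X).

(* f_(w1 ... wn) = f_w1 \o ... \o f_wn *)
Definition word_map f (s : seq I) : X -> X := foldr (fun i g => f i \o g) id s.

Definition orbit_of f x : set X := [set word_map f s x | s in [set: seq I]].

Definition orbital_contractive_ifs f : Prop :=
  [/\ complete_space X,
      (0 < #|I|)%N,
      forall i, continuous (f i) &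
      exists2 C : R, 0 <= C < 1 &
        forall x i y z, orbit_of f x y -> orbit_of f x z ->
          mdist (f i y) (f i z) <= C * mdist y z].

End ifs.

Section fuzzy_sets.
Context {R : realType} {X : metricType R}.
Implicit Types (u v : X -> R) (T : X -> X) (A B : set X).

Definition level u (a : R) : set X :=
  if a == 0 then closure [set x | 0 < u x] else [set x | a <= u x].

(* A fuzzy set is encoded as a real-valued function; membership of its values
   in [0, 1] is part of F_X**. *)
Definition fuzzy_set u : Prop := forall x, 0 <= u x <= 1.

Definition fuzzy_normal u : Prop := exists x, u x = 1.

Definition compactly_supported u : Prop := compact (level u 0).

Definition usc u : Prop := forall a : R, closed [set x | a <= u x].

Definition FXss : set (X -> R) :=
  [set u | [/\ fuzzy_set u, fuzzy_normal u & compactly_supported u]].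

Definition fuzzy_image T u : X -> R := fun y =>
  if y \in range T then sup [set u x | x in T @^-1` [set y]] else 0.

(* Meant for nonempty bounded sets, where all the suprema and infima below are
   genuine (sup and inf return 0 on unbounded or empty sets of reals).  For
   members of FXss the levels with index in [0, 1] are nonempty, by normality,
   and lie in the compact support, so hausdorff_dist and dinfty are applied
   within that range. *)
Definition hausdorff_dist A B : R :=
  Num.max (sup [set inf [set mdist x y | y in B] | x in A])
          (sup [set inf [set mdist x y | x in A] | y in B]).

Definition dinfty u v : R :=
  sup [set hausdorff_dist (level u a) (level v a) | a in `[0, 1]%classic].

End fuzzy_sets.

Section fuzzy_ifs.
Context {R : realType} {X : metricType R} {I : finType}.
Implicit Types (f : I -> X -> X) (rho : I -> R -> R) (u : X -> R).

(* Grey level maps [0, 1] -> [0, 1] are encoded as functions R -> R of which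
   only the restriction to [0, 1] is constrained (and used).  Right continuity
   is void at the right end point 1 of the domain. *)
Definition admissible rho : Prop :=
  (forall i, [/\ forall t : R, t \in `[0, 1] -> rho i t \in `[0, 1],
                 exists2 t : R, t \in `[0, 1] & rho i t != 0,
                 {in `[0, 1] &, {homo rho i : s t / s <= t}},
                 forall t : R, t \in `[0, 1[ -> rho i s @[s --> t^'+] --> rho i t &
                 rho i 0 = 0]) /\
  exists i, rho i 1 = 1.

Definition orbital_fuzzy_ifs f rho : Prop :=
  orbital_contractive_ifs f /\ admissible rho.

(* The default value 0 of the iterated maximum is harmless: I is nonempty and
   the grey level maps are nonnegative on [0, 1]. *)
Definition hutchinson_barnsley f rho u : X -> R := fun x =>
  \big[Num.max/0]_(i : I) rho i (fuzzy_image (f i) u x).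

Definition FSss f : set (X -> R) :=
  FXss `&` [set u | forall x, 0 < u x ->
    exists w y, [/\ closure (orbit_of f w) y, closure (orbit_of f w) x & u y = 1]].

Definition FSs f : set (X -> R) := FSss f `&` [set u | usc u].

End fuzzy_ifs.

Definition weakly_Picard (R : realType) (T : Type) (E : set T) (d : T -> T -> R)
    (Z : T -> T) : Prop :=
  (forall u, E u -> E (Z u)) /\
  (forall u, E u -> exists v, [/\ E v, Z v = v &
     d (iter n Z u) v @[n --> \oo] --> (0 : R)]).

(* Main.v *)
(* For u in F_S* write u_n = Z^n u.  A point x with u_n x > 0 is f_s x0 for a
   word s of length n and some x0 with u x0 > 0, and u_n x = rho_s (u x0).  By
   definition of F_S*, x0 lies in the closure of an orbit that also adheres to
   some y with u y = 1.  For m >= n, the point f_s (f_j^(m-n) y), where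
   rho_j 1 = 1, has grade at least rho_s 1 >= u_n x in u_m, and by contraction
   along the orbit closure it is within L C^n of x, where L bounds the distances
   d(x, f_t y) for x, y in the support of u.  The same works from u_m to u_n, so
   the sequence is Cauchy for d_infty.  Its limit is
   v x = inf_n sup {u_n y | d(x, y) <= L C^n}.  Continuity of Z on such limits
   is not metric, since a point and its approximants may lie on different
   orbits; Z v = v and v in F_S* come from compactness instead, by taking limits
   along an ultrafilter on nat, which exist because the supports are compact and
   X is complete. *)

Require Import Defs.
From mathcomp Require Import all_boot all_order all_algebra.
From mathcomp Require Import all_classical all_reals all_analysis.
From mathcomp Require Import lra.

Set Implicit Arguments.
Unset Strict Implicit.
Unset Printing Implicit Defensive.

Import Order.TTheory GRing.Theory Num.Theory.
Import numFieldNormedType.Exports.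
Import metricType_numDomainType.

Local Open Scope classical_set_scope.
Local Open Scope ring_scope.

(** * Limits along ultrafilters *)

(** An ultrafilter converges to each of its cluster points: of a neighbourhood and its complement
    one has its preimage in [G], and it cannot be the complement. Limits along one fixed [G] replace
    successive extractions of subsequences. *)
Lemma compact_ultra_cvg (T : Type) (X : topologicalType) (A : set X)
    (G : set_system T) (z : T -> X) :
  UltraFilter G -> compact A -> (\forall t \near G, A (z t)) ->
  exists2 y, A y & z @ G --> y.
Proof.
move=> GU cA GA; have [|y [Ay cly]] := cA (z @ G) _; first exact: GA.
exists y => // V Vy.
have [//|GV] := in_ultra_setVsetC (z @^-1` V) GU.
by have [p []] := cly (~` V) V GV Vy.
Qed.

(** Pigeonhole: if no value were taken [G]-eventually, the finitely many complements would meet in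
    an empty member of [G]. *)
Lemma ultra_finite (T : Type) (J : finType) (G : set_system T) (c : T -> J) :
  UltraFilter G -> exists j, \forall t \near G, c t = j.
Proof.
move=> GU; apply: contrapT => /forallNP nG.
have : \forall t \near G, forall j, c t <> j.
  apply: filter_forall => j.
  by have [/nG//|] := in_ultra_setVsetC [set t | c t = j] GU.
by move=> /filter_ex[t /(_ (c t))].
Qed.

Lemma free_ultrafilter :
  exists G : set_system nat, UltraFilter G /\ \oo `<=` G.
Proof. exact: ultraFilterLemma. Qed.

(** * Limits and compactness in metric spaces *)

Section metric.
Context {R : realType} {X : metricType R}.
Implicit Types (x y z : X) (A B K : set X).

Lemma near_mdist (T : Type) (G : set_system T) (x : T -> X) (a : X) (e : R)
    {FG : Filter G} :
  x @ G --> a -> 0 < e -> \forall t \near G, mdist a (x t) < e.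
Proof. by move=> /cvgrPdist_lt; exact. Qed.

Lemma near_lt0 (T : Type) (G : set_system T) (r : T -> R) (e : R)
    {FG : Filter G} :
  r @ G --> 0 -> 0 < e -> \forall t \near G, r t < e.
Proof. by move=> r0 e0; exact: (cvgr_lt _ r0). Qed.

Lemma mdist_limit_le (T : Type) (G : set_system T) (x y : T -> X) (a b : X)
    (r : R) :
  ProperFilter G -> x @ G --> a -> y @ G --> b ->
  (\forall t \near G, mdist (x t) (y t) <= r) -> mdist a b <= r.
Proof.
move=> GP xa yb xy; apply/ler_addgt0Pl => e e0.
have e2 : 0 < e / 2 by rewrite divr_gt0.
have [t [[txa tyb] txy]] := filter_ex (filterI (filterI
  (near_mdist xa e2) (near_mdist yb e2)) xy).
have h1 := metric_triangle a (x t) b.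
have h2 := metric_triangle (x t) (y t) b.
rewrite (metric_sym (y t) b) in h2.
simpl in *; lra.
Qed.

Lemma cvg_mdist_le (T : Type) (G : set_system T) (x y : T -> X) (a : X) :
  Filter G -> x @ G --> a ->
  (forall e : R, 0 < e -> \forall t \near G, mdist (x t) (y t) < e) ->
  y @ G --> a.
Proof.
move=> FG xa xy; apply/cvgrPdist_lt => e e0.
have e2 : 0 < e / 2 by rewrite divr_gt0.
apply: filterS2 (xy _ e2) (near_mdist xa e2) => t /= h1 h2.
have := metric_triangle a (x t) (y t); lra.
Qed.

Lemma mdist0_cvg (T : Type) (G : set_system T) (x : T -> X) (a : X)
    (r : T -> R) :
  Filter G -> r @ G --> 0 -> (\forall t \near G, mdist a (x t) <= r t) ->
  x @ G --> a.
Proof.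
move=> FG r0 xr; apply/cvgrPdist_lt => e e0.
apply: filterS2 xr (near_lt0 r0 e0) => t.
exact: le_lt_trans.
Qed.

Lemma compact_mdist_bounded x A : compact A ->
  exists b, forall y, A y -> mdist x y <= b.
Proof.
move=> cA; have [G [GU ooG]] := free_ultrafilter.
apply: contrapT => /forallNP nb.
have /choice[y yP] n : exists y, A y /\ n%:R < mdist x y.
  have /existsNP[y /not_implyP[Ay /negP]] := nb n%:R.
  by rewrite -ltNge => xy; exists y.
have [a Aa ya] : exists2 a, A a & y @ G --> a.
  by apply: compact_ultra_cvg cA _; apply: nearW => n; have [] := yP n.
have bG : G [set n : nat | mdist x a + 1 <= n%:R].
  by apply: ooG; exact: nbhs_infty_ger.
have [n [h1 h2]] := filter_ex (filterI bG (near_mdist ya (@ltr01 R))).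
have := (yP n).2; have := metric_triangle x a (y n).
by simpl in *; lra.
Qed.

(* Plays the role of "complete and totally bounded implies compact": the nearest
   points in [K n] converge along [G], so [x @ G] is Cauchy. *)
Lemma complete_ultra_cvg (T : Type) (G : set_system T) (x : T -> X)
    (K : nat -> set X) (r : nat -> R) :
  complete_space X -> UltraFilter G -> r @ \oo --> 0 ->
  (forall n, compact (K n)) ->
  (forall n, \forall t \near G, exists2 y, K n y & mdist (x t) y <= r n) ->
  exists2 a, x @ G --> a & forall n, exists2 y, K n y & mdist a y <= r n.
Proof.
move=> cX GU r0 cK xK.
have /choice[p pP] n : exists p : T -> X,
    \forall t \near G, K n (p t) /\ mdist (x t) (p t) <= r n.
  have /choice[p pP] t : exists q,
      (exists2 y, K n y & mdist (x t) y <= r n) ->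
      K n q /\ mdist (x t) q <= r n.
    have [[y Ky xy]|nK] := pselect (exists2 y, K n y & mdist (x t) y <= r n).
      by exists y.
    by exists (x t).
  by exists p; apply: filterS (xK n) => t; exact: pP.
have /choice[b bP] n : exists b : X, K n b /\ p n @ G --> b.
  have [|b Kb pb] := compact_ultra_cvg (z := p n) GU (cK n).
    by apply: filterS (pP n) => t [].
  by exists b.
have [a xa] : exists a : X, x @ G --> a.
  apply: cX; apply: cauchy_exP => e e0.
  have e2 : 0 < e / 2 by rewrite divr_gt0.
  have [n rn] := filter_ex (near_lt0 r0 e2).
  exists (b n); rewrite ballEmdist.
  apply: filterS2 (pP n) (near_mdist (bP n).2 e2) => t [_ h1] h2 /=.
  have := metric_triangle (b n) (p n t) (x t).
  by rewrite (metric_sym (p n t)); simpl in *; lra.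
exists a => // n; exists (b n); first by have [] := bP n.
apply: mdist_limit_le xa (bP n).2 _.
by apply: filterS (pP n) => t [].
Qed.

(** For points tending to [x], their companions in [K] converge along an ultrafilter by compactness,
    and the bound [r] passes to the limit. *)
Lemma closed_thickening K (r : R) : compact K ->
  closed [set x | exists2 y, K y & mdist x y <= r].
Proof.
move=> cK x; rewrite closureEcvg => -[G GP [Gx sG]].
have [H [HU GH]] := ultraFilterLemma GP.
have Hx : id @ H --> x by move=> V /Gx/GH.
have Hs : H [set x | exists2 y, K y & mdist x y <= r] by apply/GH/sG.
have /choice[p pP] t : exists q,
    (exists2 y, K y & mdist t y <= r) -> K q /\ mdist t q <= r.
  have [[y Ky xy]|nK] := pselect (exists2 y, K y & mdist t y <= r).
    by exists y.
  by exists t.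
have [|y Ky py] := compact_ultra_cvg (z := p) HU cK.
  by apply: filterS Hs => t /pP[].
exists y => //; apply: mdist_limit_le Hx py _.
by apply: filterS Hs => t /pP[].
Qed.

Lemma closed_mdist_ball (x : X) (e : R) : closed [set y | mdist x y <= e].
Proof.
rewrite (_ : mkset _ = [set y | exists2 z, [set x] z & mdist y z <= e]).
  by apply: closed_thickening; exact: compact_set1.
apply/seteqP; split => [y xy|y [_ -> xy]] /=; last by rewrite metric_sym.
by exists x => //; rewrite metric_sym.
Qed.

End metric.

(** * Upper semicontinuous fuzzy sets and bounds on d_infty *)

Section fuzzy.
Context {R : realType} {X : metricType R}.
Implicit Types (u v : X -> R) (A B : set X).

Definition FXs : set (X -> R) := FXss `&` [set u | usc u].

Lemma FXs_ge0 u x : FXs u -> 0 <= u x.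
Proof. by move=> [[fu _ _] _]; have /andP[] := fu x. Qed.

Lemma FXs_le1 u x : FXs u -> u x <= 1.
Proof. by move=> [[fu _ _] _]; have /andP[] := fu x. Qed.

Lemma pos_level0 u x : 0 < u x -> level u 0 x.
Proof. by move=> ux; rewrite /level eqxx; exact: subset_closure. Qed.

Lemma FXs_compact_level0 u : FXs u -> compact (level u 0).
Proof. by move=> [[_ _]]. Qed.

Lemma FXs_compact_level u (a : R) :
  FXs u -> 0 < a -> compact [set x | a <= u x].
Proof.
move=> [[_ _ cu] uu] a0; apply: subclosed_compact (uu a) cu _ => x /= ax.
exact/pos_level0/(lt_le_trans a0).
Qed.

Lemma FXs_ultra_cvg (T : Type) (G : set_system T) (z : T -> X) u (a : R) :
  UltraFilter G -> FXs u -> 0 < a -> (\forall t \near G, a <= u (z t)) ->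
  exists2 y, a <= u y & z @ G --> y.
Proof.
move=> GU uF a0 Ga.
by have [] := compact_ultra_cvg GU (FXs_compact_level uF a0) Ga => y; exists y.
Qed.

(** If [u] vanishes on [B], any point will do. Otherwise a maximizing sequence is eventually in the
    compact level of index [s / 2], and upper semicontinuity bounds the grade of its limit from
    below by [s - e] for every [e]. *)
Lemma FXs_attained u B x0 : FXs u -> closed B -> B x0 ->
  exists2 x, B x & forall y, B y -> u y <= u x.
Proof.
move=> uF cB Bx0.
have [[x1 Bx1 ux1]|nB] := pselect (exists2 x, B x & 0 < u x); last first.
  exists x0 => // y By; rewrite leNgt; apply/negP => uxy.
  by apply: nB; exists y => //; apply: le_lt_trans uxy; exact: FXs_ge0.
have supB : has_sup [set u y | y in B].
  split; first by exists (u x1), x1.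
  by exists 1 => _ [y _ <-]; exact: FXs_le1.
have [G [GU ooG]] := free_ultrafilter.
pose s := sup [set u y | y in B].
have s_ub y : B y -> u y <= s by move=> By; apply: (ub_le_sup supB.2); exists y.
have s0 : 0 < s by exact: lt_le_trans (s_ub _ Bx1).
have /choice[x xP] (n : nat) : exists y, B y /\ s - n.+1%:R^-1 < u y.
  have n0 : 0 < n.+1%:R^-1 :> R by rewrite invr_gt0.
  by have [_ [y By <-] uy] := sup_adherent n0 supB; exists y.
have near_s (e : R) : 0 < e -> \forall n \near G, s - e <= u (x n).
  move=> e0; have e1 : \forall n \near G, n.+1%:R^-1 < e :> R.
    by apply: ooG; exact: near_infty_natSinv_lt (PosNum e0).
  apply: filterS e1 => n /= ne; apply: le_trans (ltW (xP n).2).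
  by rewrite lerD2l lerN2 ltW.
have [a _ xa] : exists2 a, s / 2 <= u a & x @ G --> a.
  apply: FXs_ultra_cvg uF _ _; first by rewrite divr_gt0.
  by apply: filterS (near_s (s / 2) _) => [n|]; rewrite ?divr_gt0//; lra.
exists a.
  by apply: (closed_cvg _ cB _ _ xa); apply: nearW => n; have [] := xP n.
move=> y /s_ub us; apply: (le_trans us); apply/ler_addgt0Pl => e /near_s ne.
rewrite -lerBlDl; have [_ uu] := uF.
exact: (closed_cvg _ (uu (s - e)) ne _ xa).
Qed.

Lemma sup_attained u B x : (forall y, B y -> u y <= u x) -> B x ->
  sup [set u y | y in B] = u x.
Proof.
move=> ux Bx; apply/eqP; rewrite eq_le; apply/andP; split.
  by apply: ge_sup; [exists (u x), x | move=> _ [y /ux uy <-]].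
apply: ub_le_sup; last by exists x.
by exists (u x) => _ [y /ux uy <-].
Qed.

(** One half of d_infty(u, v) <= r: each level of [u] of positive index lies in the [r]-thickening
    of the level of [v] of the same index. At a point [x] it is enough to treat the index [u x]. *)
Definition fuzzy_approx u v (r : R) : Prop :=
  forall x, 0 < u x -> exists2 y, u x <= v y & mdist x y <= r.

Lemma sup_ge0 (A : set R) : (forall t, A t -> 0 <= t) -> 0 <= sup A.
Proof.
(* Without a supremum, [sup] takes its default value 0, which satisfies the bound. *)
move=> A0; have [supA|/sup_out->//] := pselect (has_sup A).
have [t At] := supA.1; exact: le_trans (A0 t At) (ub_le_sup supA.2 At).
Qed.

Lemma inf_ge0 (A : set R) : (forall t, A t -> 0 <= t) -> 0 <= inf A.
Proof.
move=> A0; have [A1|/nonemptyPn->] := pselect (A !=set0).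
  exact: lb_le_inf.
by rewrite inf0.
Qed.

Lemma inf_mdist_le x B (r : R) :
  (forall e : R, 0 < e -> exists2 y, B y & mdist x y <= r + e) ->
  inf [set mdist x y | y in B] <= r.
Proof.
move=> rB; apply/ler_addgt0Pr => e /rB[y By xy]; apply: le_trans xy.
apply: ge_inf; last by exists y.
by exists 0 => _ [z _ <-]; exact: mdist_ge0.
Qed.

(** The slack [e] serves the level of index 0: a point of that closure must first be moved to a
    nearby point of positive grade before [fuzzy_approx] applies. *)
Lemma hausdorff_dist_le A B (r : R) : A !=set0 -> B !=set0 ->
  (forall x, A x -> forall e, 0 < e -> exists2 y, B y & mdist x y <= r + e) ->
  (forall x, B x -> forall e, 0 < e -> exists2 y, A y & mdist x y <= r + e) ->
  hausdorff_dist A B <= r.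
Proof.
move=> [a Aa] [b Bb] AB BA; rewrite /hausdorff_dist ge_max; apply/andP; split.
  apply: ge_sup; first by eexists; exists a.
  by move=> _ [x /AB xB <-]; exact: inf_mdist_le.
apply: ge_sup; first by eexists; exists b.
move=> _ [x /BA xA <-].
rewrite (_ : [set mdist _ x | _ in A] = [set mdist x y | y in A]).
  exact: inf_mdist_le.
by apply/seteqP; split=> _ [y Ay <-]; exists y => //; rewrite metric_sym.
Qed.

Lemma hausdorff_dist_ge0 A B : 0 <= hausdorff_dist A B.
Proof.
rewrite /hausdorff_dist le_max; apply/orP; left.
apply: sup_ge0 => _ [x _ <-]; apply: inf_ge0 => _ [y _ <-]; exact: mdist_ge0.
Qed.

Lemma level_nonempty u a : fuzzy_normal u -> 0 <= a <= 1 -> level u a !=set0.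
Proof.
move=> [x ux] /andP[a0 a1]; exists x; rewrite /level; case: ifP => _ /=.
  by apply: subset_closure; rewrite /= ux.
by rewrite ux.
Qed.

Lemma fuzzy_approx_level u v (r a : R) : fuzzy_approx u v r -> 0 <= a ->
  forall x, level u a x -> forall e, 0 < e ->
  exists2 y, level v a y & mdist x y <= r + e.
Proof.
move=> uv a0 x + e e0; rewrite /level; case: ifPn => [_ clx|an0 /= ax].
  have [z [/= /[dup] uz /uv[y vy zy]]] := clx _ (nbhsx_ballx x _ e0).
  rewrite ballEmdist /= => xz; exists y.
    by apply: subset_closure; exact: lt_le_trans vy.
  by have := metric_triangle x z y; simpl in *; lra.
have u0 : 0 < u x by apply: lt_le_trans ax; rewrite lt_neqAle eq_sym an0.
have [y vy xy] := uv x u0; exists y; first exact: le_trans vy.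
by rewrite (le_trans xy)// lerDl ltW.
Qed.

Lemma dinfty_ge0 u v : 0 <= dinfty u v.
Proof. by apply: sup_ge0 => _ [a _ <-]; exact: hausdorff_dist_ge0. Qed.

Lemma fuzzy_approx_dinfty u v (r : R) : fuzzy_normal u -> fuzzy_normal v ->
  fuzzy_approx u v r -> fuzzy_approx v u r -> dinfty u v <= r.
Proof.
move=> nu nv uv vu; apply: ge_sup.
  by eexists; exists 0 => //=; rewrite in_itv /= lexx ler01.
move=> _ [a +] <-; rewrite /= in_itv /= => a01; have [a0 _] := andP a01.
apply: hausdorff_dist_le; [exact: level_nonempty..| |].
- exact: fuzzy_approx_level.
- exact: fuzzy_approx_level.
Qed.

End fuzzy.

(** * Limits of Cauchy sequences of fuzzy sets *)

Section limit.
Context {R : realType} {X : metricType R} (u : nat -> X -> R) (r : nat -> R).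
Context (cX : complete_space X) (uF : forall n, FXs (u n)).
Context (r0 : r @ \oo --> 0) (r_ge0 : forall n, 0 <= r n).
Context (uu : forall n m, (n <= m)%N -> fuzzy_approx (u n) (u m) (r n)).
Context (uuV : forall n m, (n <= m)%N -> fuzzy_approx (u m) (u n) (r n)).

(** The pointwise largest [w] with [fuzzy_approx w (u n) (r n)] for all [n]. *)
Definition fuzzy_limit x : R :=
  inf [set sup [set u n y | y in [set y | mdist x y <= r n]] | n in [set: nat]].

(** The suprema over closed balls are attained, so a lower bound of the infimum is tested by one
    point in each ball. Each level of the limit is thus the intersection of the [r n]-thickenings of
    the levels of [u n]. *)
Lemma fuzzy_limit_geP x a :
  a <= fuzzy_limit x <-> forall n, exists2 y, mdist x y <= r n & a <= u n y.
Proof.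
have /choice[y yP] n : exists y, mdist x y <= r n /\
    forall z, mdist x z <= r n -> u n z <= u n y.
  have [||y] := @FXs_attained _ _ (u n) [set y | mdist x y <= r n] x (uF n).
  - exact: closed_mdist_ball.
  - by rewrite /= mdistxx.
  by exists y.
have -> : fuzzy_limit x = inf [set u n (y n) | n in [set: nat]].
  congr inf; apply/seteqP; split=> _ [n _ <-]; exists n => //;
    [apply/esym|]; apply: sup_attained; have [] := yP n => //.
split=> [ax n|ax].
  exists (y n); first by have [] := yP n.
  apply: le_trans ax _; apply: ge_inf; last by exists n.
  by exists 0 => _ [m _ <-]; exact: FXs_ge0.
apply: lb_le_inf; first by exists (u 0%N (y 0%N)), 0%N.
move=> _ [n _ <-]; have [z xz az] := ax n.
by apply: le_trans az _; exact: (yP n).2.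
Qed.

Lemma fuzzy_approx_fuzzy_limitV n : fuzzy_approx fuzzy_limit (u n) (r n).
Proof.
move=> x _; have [y xy uy] := (fuzzy_limit_geP x _).1 (lexx _) n.
by exists y.
Qed.

(** The source of points of the limit. For [k >= n], [x k] is within [r n] of the compact level of
    [u n] of index [a], so completeness gives a limit [y]; it is still within [r n] of that level,
    which is the criterion of [fuzzy_limit_geP]. *)
Lemma fuzzy_limit_cvg (G : set_system nat) (x : nat -> X) a :
  UltraFilter G -> \oo `<=` G -> 0 < a -> (\forall k \near G, a <= u k (x k)) ->
  exists2 y, x @ G --> y & a <= fuzzy_limit y.
Proof.
move=> GU ooG a0 ax.
have [n|n|y xy yP] := @complete_ultra_cvg _ _ _ G x
    (fun n => [set z | a <= u n z]) r cX GU r0.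
- exact: FXs_compact_level.
- have nG : \forall k \near G, (n <= k)%N by apply: ooG; exact: nbhs_infty_ge.
  apply: filterS2 ax nG => k ak nk.
  have [z uz xz] := uuV nk (lt_le_trans a0 ak).
  by exists z => //; exact: le_trans uz.
exists y => //; apply/fuzzy_limit_geP => n.
by have [z] := yP n; exists z.
Qed.

Lemma fuzzy_approx_fuzzy_limit n : fuzzy_approx (u n) fuzzy_limit (r n).
Proof.
move=> x ux; have [G [GU ooG]] := free_ultrafilter.
(* The witness is the limit along [G] of companions of [x] in the later terms; below [n] the value
   of [z] is a placeholder. *)
have /choice[z zP] k : exists z,
    (n <= k)%N -> u n x <= u k z /\ mdist x z <= r n.
  have [nk|nk] := leqP n k; last by exists x.
  by have [z] := uu nk ux; exists z.
have nG : \forall k \near G, (n <= k)%N by apply: ooG; exact: nbhs_infty_ge.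
have [|y zy uy] := fuzzy_limit_cvg (x := z) GU ooG ux.
  by apply: filterS nG => k /zP[].
exists y => //; apply: mdist_limit_le (cvg_cst x) zy _.
by apply: filterS nG => k /zP[].
Qed.

Lemma fuzzy_limit_FXs : FXs fuzzy_limit.
Proof.
have lim_ge0 x : 0 <= fuzzy_limit x.
  apply/fuzzy_limit_geP => n; exists x; first by rewrite mdistxx.
  exact: FXs_ge0.
have lim_le1 x : fuzzy_limit x <= 1.
  have [y _ uy] := (fuzzy_limit_geP x _).1 (lexx _) 0%N.
  by apply: le_trans uy _; exact: FXs_le1.
have lim_usc : usc fuzzy_limit.
  move=> a; have [a0|a0] := leP a 0.
    rewrite (_ : mkset _ = setT); first exact: closedT.
    by apply/seteqP; split => x //= _; exact: le_trans (lim_ge0 x).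
  (* A level of positive index is an intersection of thickenings of compact sets. *)
  rewrite (_ : mkset _ = \bigcap_n
      [set x | exists2 y, [set y | a <= u n y] y & mdist x y <= r n]).
    apply: closed_bigI => n _; apply: closed_thickening.
    exact: FXs_compact_level.
  apply/seteqP; split => [x /fuzzy_limit_geP ax n _|x ax] /=.
    by have [y] := ax n; exists y.
  by apply/fuzzy_limit_geP => n; have [y] := ax n I; exists y.
split=> //; split.
- by move=> x; rewrite lim_ge0 lim_le1.
- have [[_ [x ux] _] _] := uF 0%N.
  have ux0 : 0 < u 0%N x by rewrite ux.
  have [y uy _] := fuzzy_approx_fuzzy_limit ux0.
  by exists y; apply/eqP; rewrite eq_le lim_le1 -ux.
(* The support is within [r n] of the compact support of [u n] for every [n], hence compact by
   [complete_ultra_cvg]. *)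
have cl n : level fuzzy_limit 0 `<=`
    [set x | exists2 y, level (u n) 0 y & mdist x y <= r n].
  rewrite /level eqxx; rewrite closureE; apply: smallest_sub; last first.
    move=> x /= lx; have [y uy xy] := @fuzzy_approx_fuzzy_limitV n x lx.
    by exists y => //; apply: subset_closure; exact: lt_le_trans uy.
  apply: closed_thickening.
  by have := FXs_compact_level0 (uF n); rewrite /level eqxx.
rewrite /compactly_supported compact_ultra => G GU Gl.
have [n|n|x xG _] := @complete_ultra_cvg _ _ _ G id
  (fun n => level (u n) 0) r cX GU r0.
- exact: FXs_compact_level0.
- by apply: filterS Gl => x /(cl n).
exists x; split=> //.
suff cl0 : closed (level fuzzy_limit 0) by exact: (closed_cvg _ cl0 Gl _ xG).
by rewrite /level eqxx; exact: closed_closure.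
Qed.

End limit.

(** * The fuzzy Hutchinson-Barnsley operator *)

(** By monotonicity the set where [g] reaches [a] is an upper part of [0, 1], and by right
    continuity it contains its infimum. Composing with [g] therefore turns levels of a fuzzy set
    into levels, and preserves upper semicontinuity. *)
Lemma grey_level_threshold (R : realType) (g : R -> R) (a : R) :
  {in `[0, 1] &, {homo g : s t / s <= t}} ->
  (forall t : R, t \in `[0, 1[ -> g s @[s --> t^'+] --> g t) ->
  exists t0, forall t, 0 <= t <= 1 -> (a <= g t) = (t0 <= t).
Proof.
move=> gm gc; pose S := [set t | 0 <= t <= 1 /\ a <= g t].
have gmono s t : 0 <= s <= 1 -> 0 <= t <= 1 -> s <= t -> g s <= g t.
  by move=> s01 t01; apply: gm; rewrite in_itv.
have [[s [s01 gs]]|S0] := pselect (S !=set0); last first.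
  (* If [a] is never reached, any threshold beyond 1 works. *)
  exists 2 => t t01; apply/idP/idP => [agt|t2].
    by case: S0; exists t.
  by have /andP[_ t1] := t01; have := le_trans t2 t1; rewrite lern1.
have lbS : has_lbound S by exists 0 => t [/andP[]].
have t0s : inf S <= s by apply: ge_inf.
have t01 : 0 <= inf S <= 1.
  have /andP[s0 s1] := s01; rewrite (le_trans t0s s1) andbT.
  by apply: lb_le_inf; [exists s | move=> t [/andP[]]].
suff gt0 : a <= g (inf S).
  exists (inf S) => t t01'; apply/idP/idP => [agt|t0t]; first exact: ge_inf.
  exact: le_trans gt0 (gmono _ _ t01 t01' t0t).
(* Right continuity says nothing at 1, but if the infimum is 1 it equals [s], which lies in [S]. *)
have /andP[t0 t1] := t01; have [t1'|t1'] := ltP (inf S) 1; last first.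
  have /andP[_ s1] := s01.
  by rewrite (_ : inf S = s)//; apply/eqP; rewrite eq_le t0s (le_trans s1 t1').
apply: (closed_cvg _ (@closed_ge _ a) _ _ (gc (inf S) _)); last first.
  by rewrite in_itv /= t0.
near=> t.
have lt_t : inf S < t by [].
have lt_t1 : t < 1 by near: t; exact: nbhs_right_lt.
have [s' [s'01 gs'] s't] : exists2 s', S s' & s' < t.
  have e0 : 0 < t - inf S by rewrite subr_gt0.
  have [|s' Ss' s't] := inf_adherent e0 (E := S).
    by split=> //; exists s.
  by exists s' => //; move: s't; rewrite addrC subrK.
apply: le_trans gs' (gmono _ _ s'01 _ (ltW s't)).
by rewrite (le_trans t0 (ltW lt_t)) ltW.
Unshelve. all: by end_near. Qed.

Section fuzzy_image.
Context {R : realType} {X : metricType R} (u : X -> R) (T : X -> X).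
Context (uF : FXs u) (Tc : continuous T).

Lemma fuzzy_image_sup x : exists x0, T x0 = T x /\
  fuzzy_image T u (T x) = u x0 /\ u x <= u x0.
Proof.
have [||x0 Tx0 ux0] := @FXs_attained _ _ u (T @^-1` [set T x]) x uF.
- apply: preimage_closed => [z _|]; first exact: Tc.
  by apply: compact_closed; [exact: metric_hausdorff | exact: compact_set1].
- by [].
exists x0; split=> //; split; last exact: ux0.
by rewrite /fuzzy_image ifT ?(sup_attained ux0)//; apply/mem_set; exists x.
Qed.

Lemma fuzzy_image_out y : ~ range T y -> fuzzy_image T u y = 0.
Proof. by move=> Ty; rewrite /fuzzy_image ifF//; exact/memNset. Qed.

Lemma fuzzy_image_ge x : u x <= fuzzy_image T u (T x).
Proof. by have [x0 [_ [->]]] := fuzzy_image_sup x. Qed.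

Lemma fuzzy_image_attained y : fuzzy_image T u y != 0 ->
  exists2 x, T x = y & fuzzy_image T u y = u x.
Proof.
have [[x _ <-] _|/fuzzy_image_out->] := pselect (range T y); last first.
  by rewrite eqxx.
by have [x0 [Tx0 [ux0 _]]] := fuzzy_image_sup x; exists x0.
Qed.

Lemma fuzzy_image_itv y : 0 <= fuzzy_image T u y <= 1.
Proof.
have [->|/fuzzy_image_attained[x _ ->]] := eqVneq (fuzzy_image T u y) 0.
  by rewrite lexx ler01.
by rewrite FXs_ge0 ?FXs_le1.
Qed.

End fuzzy_image.

Section hutchinson_barnsley.
Context {R : realType} {X : metricType R} {I : finType}.
Context (f : I -> X -> X) (rho : I -> R -> R).
Context (fC : forall i, continuous (f i)) (rA : admissible rho).
Local Notation Z := (hutchinson_barnsley f rho).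

Lemma grey_level_itv i t : 0 <= t <= 1 -> 0 <= rho i t <= 1.
Proof. by have [+ _ _ _ _] := rA.1 i; move=> /(_ t); rewrite !in_itv. Qed.

Lemma grey_level_le i s t : 0 <= s -> s <= t -> t <= 1 -> rho i s <= rho i t.
Proof.
move=> s0 st t1; have [_ _ rm _ _] := rA.1 i.
by apply: rm => //; rewrite in_itv /= ?s0 ?t1 ?(le_trans s0 st)
  ?(le_trans st t1).
Qed.

Lemma grey_level0 i : rho i 0 = 0.
Proof. by have [] := rA.1 i. Qed.

Lemma grey_level_gt0 i t : 0 <= t -> 0 < rho i t -> 0 < t.
Proof.
rewrite le_eqVlt => /predU1P[<-|//]; by rewrite grey_level0 ltxx.
Qed.

Lemma hutchinson_barnsley_ge u i x : FXs u -> rho i (u x) <= Z u (f i x).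
Proof.
move=> uF; rewrite /hutchinson_barnsley.
apply: (@le_trans _ _ (rho i (fuzzy_image (f i) u (f i x)))).
  apply: grey_level_le; first exact: FXs_ge0.
    exact: fuzzy_image_ge.
  by have /andP[] := fuzzy_image_itv uF (@fC i) (f i x).
exact: le_bigmax.
Qed.

(** A positive maximum is one of its terms rather than the default 0; since [rho i 0 = 0], the image
    has positive grade at [x], and the supremum over the fibre is attained. *)
Lemma hutchinson_barnsley_attained u x : FXs u -> 0 < Z u x ->
  exists i x0, [/\ f i x0 = x, 0 < u x0 & Z u x = rho i (u x0)].
Proof.
move=> uF.
have [->|[i ->]] : Z u x = 0 \/
    exists i, Z u x = rho i (fuzzy_image (f i) u x).
- rewrite /hutchinson_barnsley.
  elim/big_ind : _ => [|s t hs ht|i _]; [by left| |].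
  by rewrite /Num.max; case: ifP.
  by right; exists i.
- by rewrite ltxx.
move=> ri0; have /andP[im0 _] := fuzzy_image_itv uF (@fC i) x.
have := grey_level_gt0 im0 ri0; rewrite lt0r => /andP[/fuzzy_image_attained].
move=> /(_ uF (@fC i))[x0 fx0 ux0] _.
exists i, x0; split=> //; last by rewrite ux0.
by rewrite -ux0; exact: grey_level_gt0 ri0.
Qed.

Lemma hutchinson_barnsley_itv u x : FXs u -> 0 <= Z u x <= 1.
Proof.
move=> uF; rewrite /hutchinson_barnsley.
elim/big_ind : _ => [|s t hs ht|i _]; first by rewrite lexx ler01.
  by rewrite /Num.max; case: ifP.
by apply: grey_level_itv; exact: fuzzy_image_itv.
Qed.

(** The compactness step behind both the upper semicontinuity of [Z u] and the inequality v <= Z v.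
    The letter is constant along [G] by finiteness, the points converge in the support, and the
    threshold of [rho j] makes the bound a closed condition. *)
Lemma grey_level_ultra (T : Type) (G : set_system T) (i : T -> I) (z : T -> X)
    u a :
  UltraFilter G -> FXs u -> 0 < a ->
  (\forall t \near G, a <= rho (i t) (u (z t))) ->
  exists j y, [/\ \forall t \near G, i t = j, z @ G --> y & a <= rho j (u y)].
Proof.
move=> GU uF a0 Ga; have [j Gj] := ultra_finite i GU.
have [|y _ zy] := compact_ultra_cvg (z := z) GU (FXs_compact_level0 uF).
  apply: filterS Ga => t at_; apply/pos_level0/(@grey_level_gt0 (i t)).
    exact: FXs_ge0.
  exact: lt_le_trans at_.
exists j, y; split=> //.
have [_ _ rm rc _] := rA.1 j.
have [t0 t0P] := grey_level_threshold a rm rc.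
have itv w : 0 <= u w <= 1 by rewrite FXs_ge0 ?FXs_le1.
rewrite t0P//; apply: (closed_cvg _ (uF.2 t0) _ _ zy).
by apply: filterS2 Gj Ga => t ->; rewrite t0P.
Qed.

Lemma hutchinson_barnsley_FXs u : FXs u -> FXs (Z u).
Proof.
move=> uF; split; last first.
  move=> a; have [a0|a0] := leP a 0.
    rewrite (_ : mkset _ = setT); first exact: closedT.
    apply/seteqP; split => x //= _; apply: le_trans a0 _.
    by have /andP[] := hutchinson_barnsley_itv x uF.
  (* Points of grade at least [a] tending to [x] have preimages that, along an ultrafilter, use one
     letter [j] and converge to some [y]; then [x = f j y] by uniqueness of limits. *)
  move=> x; rewrite closureEcvg => -[G0 GP [Gx sG]].
  have [G [GU GG]] := ultraFilterLemma GP.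
  have {}Gx : id @ G --> x by move=> V /Gx/GG.
  have {sG}Gs : G [set x | a <= Z u x] by apply/GG/sG.
  have /choice[p pP] t : exists p : I * X, a <= Z u t ->
      f p.1 p.2 = t /\ a <= rho p.1 (u p.2).
    have [at_|nat_] := leP a (Z u t); last first.
      by have [i _] := rA.2; exists (i, t).
    have [i [z [fz _ zu]]] :=
      hutchinson_barnsley_attained uF (lt_le_trans a0 at_).
    by exists (i, z); rewrite -zu.
  have [|j [y [Gj zy ay]]] := @grey_level_ultra _ G (fun t => (p t).1)
      (fun t => (p t).2) u a GU uF a0.
    by apply: filterS Gs => t /pP[].
  rewrite (_ : x = f j y); last first.
    apply: (cvg_unique (@metric_hausdorff _ X) Gx).
    apply: cvg_trans (cvg_comp _ _ zy (fC (x := y))).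
    by apply: near_eq_cvg; apply: filterS2 Gj Gs => t /= <- /pP[].
  exact: le_trans ay (hutchinson_barnsley_ge _ _ uF).
split.
- by move=> x; exact: hutchinson_barnsley_itv.
- have [i ri1] := rA.2; have [[_ [x ux] _] _] := uF.
  exists (f i x); apply/eqP; rewrite eq_le.
  have /andP[_ ->] := hutchinson_barnsley_itv (f i x) uF.
  by rewrite -ri1 -ux hutchinson_barnsley_ge.
rewrite /compactly_supported /level eqxx.
(* The support of [Z u] lies in the finite union of the images of the support of [u]. *)
have cK : compact (\big[setU/set0]_(i : I) (f i @` level u 0)).
  apply: bigsetU_compact => i _; apply: continuous_compact.
    exact: continuous_subspaceT.
  exact: FXs_compact_level0.
apply: (subclosed_compact _ cK _); first exact: closed_closure.
rewrite closureE; apply: smallest_sub.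
  exact: compact_closed (@metric_hausdorff _ X) cK.
move=> x /(hutchinson_barnsley_attained uF)[i [x0 [<- ux0 _]]].
rewrite (bigD1 i)//=; left; exists x0 => //; exact: pos_level0.
Qed.

End hutchinson_barnsley.

(** * Words: iterates of [Z] and contraction on orbit closures *)

Section words.
Context {R : realType} {X : metricType R} {I : finType}.
Context (f : I -> X -> X) (rho : I -> R -> R).
Context (fC : forall i, continuous (f i)) (rA : admissible rho).
Local Notation Z := (hutchinson_barnsley f rho).
Local Notation fw := (word_map f).

Definition grey_word (s : seq I) : R -> R := foldr (fun i g => rho i \o g) id s.

Lemma grey_word_itv s t : 0 <= t <= 1 -> 0 <= grey_word s t <= 1.
Proof. by move=> t01; elim: s => //= i s; exact: (grey_level_itv rA). Qed.

Lemma grey_word_le s t t' : 0 <= t -> t <= t' -> t' <= 1 ->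
  grey_word s t <= grey_word s t'.
Proof.
move=> t0 tt' t1; elim: s => //= i s IH; apply: (grey_level_le rA) => //.
  have /andP[//] : 0 <= grey_word s t <= 1.
    by rewrite grey_word_itv// t0 (le_trans tt' t1).
have /andP[//] : 0 <= grey_word s t' <= 1.
  by rewrite grey_word_itv// t1 (le_trans t0 tt').
Qed.

Lemma grey_word_nseq1 k j : rho j 1 = 1 -> grey_word (nseq k j) 1 = 1.
Proof. by move=> j1; elim: k => //= k ->. Qed.

Lemma word_map_cat s t x : fw (s ++ t) x = fw s (fw t x).
Proof. by elim: s => //= i s ->. Qed.

Lemma word_map_continuous s : continuous (fw s).
Proof.
elim: s => [x|i s IH x] /=; first exact: cvg_id.
exact: continuous_comp (IH x) (fC (x := fw s x)).
Qed.

Lemma iter_FXs n u : FXs u -> FXs (iter n Z u).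
Proof. by move=> uF; elim: n => //= n; exact: hutchinson_barnsley_FXs. Qed.

(** With [iter_ge], this makes a positive [iter n Z u x] the maximum of [grey_word s (u x0)] over
    the words [s] of length [n] and the points [x0] sent to [x] by [s]. *)
Lemma iter_attained n u x : FXs u -> 0 < iter n Z u x ->
  exists s x0, [/\ size s = n, fw s x0 = x, 0 < u x0 &
                   iter n Z u x = grey_word s (u x0)].
Proof.
move=> uF; elim: n x => [x ux|n IH x /=]; first by exists [::], x.
move=> /(hutchinson_barnsley_attained fC rA (iter_FXs n uF)).
move=> [i [x1 [<- /IH[s [x0 [<- <- ux0 ->]]] ->]]].
by exists (i :: s), x0.
Qed.

Lemma iter_ge s u x : FXs u ->
  grey_word s (u x) <= iter (size s) Z u (fw s x).
Proof.
move=> uF; elim: s => //= i s IH.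
have sF := iter_FXs (size s) uF.
apply: le_trans (hutchinson_barnsley_ge fC rA _ _ sF).
apply: (grey_level_le rA) => //; last exact: FXs_le1.
have /andP[//] : 0 <= grey_word s (u x) <= 1.
by rewrite grey_word_itv// FXs_ge0 ?FXs_le1.
Qed.

Lemma orbit_of_word x s : orbit_of f x (fw s x).
Proof. by exists s. Qed.

Lemma closure_orbit_self x : closure (orbit_of f x) x.
Proof. by apply: subset_closure; exact: (orbit_of_word x [::]). Qed.

Lemma closure_orbit_map w y i :
  closure (orbit_of f w) y -> closure (orbit_of f w) (f i y).
Proof.
move=> cy V /fC/cy[_ [[s _ <-] Vs]]; exists (f i (fw s w)); split=> //.
by exists (i :: s).
Qed.

Lemma closure_orbit_word w y s :
  closure (orbit_of f w) y -> closure (orbit_of f w) (fw s y).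
Proof. by move=> cy; elim: s => //= i s; exact: closure_orbit_map. Qed.

Section contraction.
Context (C : R) (C01 : 0 <= C < 1).
Context (fK : forall x i y z, orbit_of f x y -> orbit_of f x z ->
  mdist (f i y) (f i z) <= C * mdist y z).

Lemma closure_contraction w i y z :
  closure (orbit_of f w) y -> closure (orbit_of f w) z ->
  mdist (f i y) (f i z) <= C * mdist y z.
Proof.
move=> cy cz; have /andP[C0 C1] := C01; apply/ler_addgt0Pr => e e0.
(* Replacing [y] and [z] by orbit points costs [e / 4] for each of the two points and for each of
   their two images. *)
have e4 : 0 < e / 4 by rewrite divr_gt0.
have near_orbit v : closure (orbit_of f w) v -> exists v', [/\ orbit_of f w v',
    mdist v v' < e / 4 & mdist (f i v) (f i v') < e / 4].
  move=> cv; have fv : f i @ v --> f i v by exact: fC.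
  have vv : id @ v --> v by [].
  have [v' [Ov' [h1 h2]]] := cv _ (filterI
    (near_mdist vv e4) (near_mdist fv e4)).
  by exists v'.
have [y' [Oy yy' fy]] := near_orbit y cy.
have [z' [Oz zz' fz]] := near_orbit z cz.
have h1 := metric_triangle (f i y) (f i y') (f i z).
have h2 := metric_triangle (f i y') (f i z') (f i z).
have h3 := fK i Oy Oz.
have h4 := metric_triangle y' y z'.
have h5 := metric_triangle y z z'.
rewrite (metric_sym y' y) in h4; rewrite (metric_sym (f i z')) in h2.
have h6 : mdist y' z' <= mdist y z + e / 2 by lra.
have h7 : C * mdist y' z' <= C * mdist y z + e / 2.
  apply: le_trans (ler_wpM2l C0 h6) _; rewrite mulrDr lerD2l.
  by apply: ler_piMl; [rewrite divr_ge0// ltW|exact: ltW].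
lra.
Qed.

Lemma word_contraction w s y z :
  closure (orbit_of f w) y -> closure (orbit_of f w) z ->
  mdist (fw s y) (fw s z) <= C ^+ size s * mdist y z.
Proof.
move=> cy cz; have /andP[C0 _] := C01.
elim: s => [|i s IH] /=; first by rewrite expr0 mul1r.
apply: le_trans (@closure_contraction w i _ _ _ _) _.
- exact: closure_orbit_word.
- exact: closure_orbit_word.
- by rewrite exprS -mulrA ler_wpM2l.
Qed.

(** If [D] bounds the first steps d(y, f_i y) on [K], an orbit from [K] stays within [D / (1 - C)]
    of its start, by induction on the word: y and f_s y lie on the same orbit, so f_i contracts
    their distance. Two points of [K] are at most [b0 + b0] apart, through [p]. *)
Lemma orbit_bounded (K : set X) : compact K ->
  exists2 L, 0 <= L & forall x y s, K x -> K y -> mdist x (fw s y) <= L.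
Proof.
move=> cK; have [[p Kp]|K0] := pselect (K !=set0); last first.
  by exists 0 => // x y s Kx; case: K0; exists x.
have /andP[C0 C1] := C01.
have [b0 b0P] := compact_mdist_bounded p cK.
have /choice[b bP] i : exists b, forall y, K y -> mdist p (f i y) <= b.
  have [|b bP] := @compact_mdist_bounded _ _ p (f i @` K).
    by apply: continuous_compact => //; exact: continuous_subspaceT.
  by exists b => y Ky; apply: bP; exists y.
pose D := b0 + \big[Num.max/0]_i b i.
have D0 : 0 <= D.
  rewrite addr_ge0//; first by apply: le_trans (b0P p Kp); exact: mdist_ge0.
  by elim/big_ind : _ => // [s t s0 t0|i _]; [rewrite le_max s0
    |apply: le_trans (bP i p Kp); exact: mdist_ge0].
have step y i : K y -> mdist y (f i y) <= D.
  move=> Ky; apply: le_trans (metric_triangle y p _) _.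
  rewrite metric_sym lerD ?b0P//; apply: le_trans (bP i y Ky) _.
  exact: le_bigmax.
(* chosen invariant under [t |-> D + C * t] *)
pose M := D / (1 - C).
have M0 : 0 <= M by rewrite divr_ge0// subr_ge0 ltW.
have ME : D + C * M = M.
  have : M * (1 - C) = D by rewrite divfK// subr_eq0 eq_sym lt_eqF.
  by lra.
have wordM y s : K y -> mdist y (fw s y) <= M.
  move=> Ky; elim: s => [|i s IH] /=; first by rewrite mdistxx.
  apply: le_trans (metric_triangle y (f i y) _) _; rewrite -ME lerD ?step//.
  apply: le_trans (fK i (orbit_of_word y [::]) (orbit_of_word y s)) _.
  exact: ler_wpM2l.
exists (b0 + b0 + M) => [|x y s Kx Ky].
  rewrite !addr_ge0//; apply: le_trans (b0P p Kp); exact: mdist_ge0.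
apply: le_trans (metric_triangle x y _) _; rewrite lerD ?wordM//.
apply: le_trans (metric_triangle x p _) _; rewrite lerD ?b0P//.
by rewrite metric_sym b0P.
Qed.

End contraction.
End words.

(** * Convergence of the iterates *)

Section picard.
Context {R : realType} {X : metricType R} {I : finType}.
Context (f : I -> X -> X) (rho : I -> R -> R).
Context (cX : complete_space X) (fC : forall i, continuous (f i)).
Context (rA : admissible rho).
Context (C : R) (C01 : 0 <= C < 1).
Context (fK : forall x i y z, orbit_of f x y -> orbit_of f x z ->
  mdist (f i y) (f i z) <= C * mdist y z).
Local Notation Z := (hutchinson_barnsley f rho).
Local Notation fw := (word_map f).

Lemma FSs_FXs u : FSs f u -> FXs u.
Proof. by move=> [[]]. Qed.

Lemma FSs_orbit u x : FSs f u -> 0 < u x -> exists w y,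
  [/\ closure (orbit_of f w) y, closure (orbit_of f w) x & u y = 1].
Proof. by move=> [[_ uO] _]; exact: uO. Qed.

Lemma hutchinson_barnsley_FSs u : FSs f u -> FSs f (Z u).
Proof.
move=> uS; have uF := FSs_FXs uS; have ZF := hutchinson_barnsley_FXs fC rA uF.
split; last exact: ZF.2.
split=> [|x]; first exact: ZF.1.
move=> /(hutchinson_barnsley_attained fC rA uF)[i [x0 [<- ux0 _]]].
have [w [y [wy wx uy]]] := FSs_orbit uS ux0.
have [j j1] := rA.2; exists w, (f j y); split; [exact: closure_orbit_map..|].
apply/eqP; rewrite eq_le FXs_le1//=.
by have := hutchinson_barnsley_ge fC rA j y uF; rewrite uy j1.
Qed.

Context (u : X -> R) (uS : FSs f u) (L : R) (L0 : 0 <= L).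
Context (LP : forall x y s,
  level u 0 x -> level u 0 y -> mdist x (fw s y) <= L).
Let uF : FXs u := FSs_FXs uS.
Let v_ n := iter n Z u.
Let r n := L * C ^+ n.

Let C0 : 0 <= C. Proof. by have /andP[] := C01. Qed.

Let vF n : FXs (v_ n). Proof. exact: iter_FXs. Qed.

Let r_cvg0 : r @ \oo --> 0.
Proof.
rewrite -(mulr0 L); apply: cvgMr; apply: cvg_expr.
by have /andP[_ C1] := C01; rewrite ger0_norm.
Qed.

Let r_ge0 n : 0 <= r n. Proof. by rewrite mulr_ge0 ?exprn_ge0. Qed.

Let contract_word w s y z :
  closure (orbit_of f w) y -> closure (orbit_of f w) z -> mdist y z <= L ->
  mdist (fw s y) (fw s z) <= r (size s).
Proof.
move=> wy wz yz; apply: le_trans (word_contraction fC C01 fK s wy wz) _.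
by rewrite /r mulrC ler_wpM2r// exprn_ge0.
Qed.

Let level1 y : u y = 1 -> level u 0 y.
Proof. by move=> uy; apply: pos_level0; rewrite uy. Qed.

Let grey_word_le1 s t : 0 <= t <= 1 -> grey_word rho s t <= grey_word rho s 1.
Proof. by move=> /andP[t0 t1]; exact: grey_word_le. Qed.

Lemma iter_nseq_eq1 j k y : rho j 1 = 1 -> u y = 1 ->
  iter k Z u (fw (nseq k j) y) = 1.
Proof.
move=> j1 uy; apply/eqP; rewrite eq_le; apply/andP; split.
  exact: FXs_le1 (vF k).
have := iter_ge fC rA (nseq k j) y uF.
by rewrite size_nseq uy grey_word_nseq1.
Qed.

Lemma fuzzy_approx_iter n m : (n <= m)%N -> fuzzy_approx (v_ n) (v_ m) (r n).
Proof.
move=> nm x vx.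
have [s [x0 [sn <- ux0 vxE]]] := iter_attained fC rA uF vx.
have [w [y [wy wx uy]]] := FSs_orbit uS ux0.
(* The letters [j] bring the word length up to [m] at no loss: [y'] has grade 1 in [v_ (m - n)]. *)
have [j j1] := rA.2; pose y' := fw (nseq (m - n) j) y.
exists (fw s y').
  have := iter_ge fC rA s y' (vF (m - n)).
  rewrite /v_ /y' iter_nseq_eq1// sn -iterD subnKC//; apply: le_trans.
  by rewrite [leLHS]vxE; apply: grey_word_le1; rewrite FXs_ge0 ?FXs_le1.
rewrite -sn; apply: contract_word wx _ _; first exact: closure_orbit_word.
by apply: LP; [exact: pos_level0|exact: level1].
Qed.

(** The word of length [m] leading to [x] splits into an outer part [s] of length [n] and an inner
    part [t]. Dropping [t] and starting [s] at [y] of grade 1 cannot lower the grade; the distance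
    from f_t x0 to [y] is what [L] has to bound. *)
Lemma fuzzy_approx_iterV n m : (n <= m)%N -> fuzzy_approx (v_ m) (v_ n) (r n).
Proof.
move=> nm x; rewrite {1 2}/v_ -(subnKC nm) iterD => vx.
have [s [x1 [sn <- vx1 ->]]] := iter_attained fC rA (vF (m - n)) vx.
have [t [x0 [_ x1E ux0 _]]] := iter_attained fC rA uF vx1.
have [w [y [wy wx uy]]] := FSs_orbit uS ux0.
exists (fw s y).
  have := iter_ge fC rA s y uF; rewrite uy sn; apply: le_trans.
  by apply: grey_word_le1; rewrite (FXs_ge0 _ (vF _)) (FXs_le1 _ (vF _)).
rewrite -sn -x1E; apply: contract_word wy _; first exact: closure_orbit_word.
by rewrite metric_sym; apply: LP; [exact: level1|exact: pos_level0].
Qed.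

Let v : X -> R := fuzzy_limit v_ r.

Let limF : FXs v.
Proof.
exact: (fuzzy_limit_FXs cX vF r_cvg0 r_ge0
  fuzzy_approx_iter fuzzy_approx_iterV).
Qed.

Let approx_lim n : fuzzy_approx (v_ n) v (r n).
Proof.
exact: (fuzzy_approx_fuzzy_limit cX vF r_cvg0 r_ge0
  fuzzy_approx_iter fuzzy_approx_iterV).
Qed.

Let approx_limV n : fuzzy_approx v (v_ n) (r n).
Proof. exact: (fuzzy_approx_fuzzy_limitV vF r_ge0). Qed.

Lemma hutchinson_barnsley_limit : Z v = v.
Proof.
have ZvF := hutchinson_barnsley_FXs fC rA limF.
(* Z v <= v: a preimage [x0] of [x] is approximated by points [y n] of the iterates. Their images
   tend to [x] by continuity of [f i] and have companions in [v] of grade at least [Z v x], so upper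
   semicontinuity of [v] concludes. *)
apply/funext => x; apply/eqP; rewrite eq_le; apply/andP; split.
  have [a0|a0] := leP (Z v x) 0; first exact: le_trans a0 (FXs_ge0 _ limF).
  have [i [x0 [fx0 vx0 vE]]] := hutchinson_barnsley_attained fC rA limF a0.
  have /choice[y yP] n : exists y, v x0 <= v_ n y /\ mdist x0 y <= r n.
    by have [y] := approx_limV n vx0; exists y.
  have yx0 : y @ \oo --> x0.
    by apply: mdist0_cvg r_cvg0 _; apply: nearW => n; have [] := yP n.
  have fyx : (fun n => f i (y n)) @ \oo --> x.
    by rewrite -fx0; exact: cvg_comp yx0 (fC (x := x0)).
  have Zv n : Z v x <= v_ n.+1 (f i (y n)).
    apply: le_trans (hutchinson_barnsley_ge fC rA i (y n) (vF n)).
    rewrite vE; apply: grey_level_le => //; [exact: FXs_ge0| |exact: FXs_le1].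
    by have [] := yP n.
  have /choice[z zP] n : exists z,
      Z v x <= v z /\ mdist (f i (y n)) z <= r n.+1.
    have [z vz fz] := approx_lim (lt_le_trans a0 (Zv n)).
    by exists z; split=> //; exact: le_trans (Zv n) vz.
  have zx : z @ \oo --> x.
    apply: cvg_mdist_le fyx _ => e e0.
    have rS : (fun n => r n.+1) @ \oo --> 0 by rewrite cvg_shiftS.
    apply: filterS (near_lt0 rS e0) => n; apply: le_lt_trans; exact: (zP n).2.
  apply: (closed_cvg _ (limF.2 (Z v x)) _ _ zx).
  by apply: nearW => n; exact: (zP n).1.
have [a0|a0] := leP (v x) 0; first exact: le_trans a0 (FXs_ge0 _ ZvF).
(* v <= Z v: near [x] there is a point of the iterate [n.+1]; [p n] holds a letter and a preimage
   producing it, and a companion of that preimage in [v]. Preimage and companion have the same limit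
   along [G]. *)
have /choice[p pP] n : exists p : I * X * X,
    [/\ mdist x (f p.1.1 p.1.2) <= r n.+1, mdist p.1.2 p.2 <= r n &
        v x <= rho p.1.1 (v p.2)].
  have [y vy xy] := approx_limV n.+1 a0.
  have [i [z [fz vz vE]]] :=
    hutchinson_barnsley_attained fC rA (vF n) (lt_le_trans a0 vy).
  have [z' vz' zz'] := approx_lim vz.
  exists (i, z, z'); rewrite /= fz; split=> //; apply: le_trans vy _.
  rewrite [leLHS]vE; apply: grey_level_le => //.
    exact: FXs_ge0.
  exact: FXs_le1.
have [G [GU ooG]] := free_ultrafilter.
have rG : r @ G --> 0 by move=> V /r_cvg0/ooG.
have [|j [y [Gj zy vy]]] := @grey_level_ultra _ _ _ _ rA _ G
  (fun n => (p n).1.1) (fun n => (p n).2) v (v x) GU limF a0.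
  by apply: nearW => n; have [] := pP n.
have zy' : (fun n => (p n).1.2) @ G --> y.
  apply: cvg_mdist_le zy _ => e e0.
  apply: filterS (near_lt0 rG e0) => n; apply: le_lt_trans.
  by rewrite metric_sym; have [] := pP n.
have fyx : (fun n => f (p n).1.1 (p n).1.2) @ G --> x.
  have rS : (fun n => r n.+1) @ \oo --> 0 by rewrite cvg_shiftS.
  apply: (@mdist0_cvg _ _ _ _ _ _ (fun n => r n.+1)).
    by move=> V /rS/ooG.
  by apply: nearW => n; have [] := pP n.
have xE : x = f j y.
  apply: (cvg_unique (@metric_hausdorff _ X) fyx).
  apply: cvg_trans (cvg_comp _ _ zy' (fC (x := y))).
  by apply: near_eq_cvg; apply: filterS Gj => n /= ->.
by apply: le_trans vy _; rewrite xE hutchinson_barnsley_ge.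
Qed.

(* [x] is a limit of points [f_(s n) (y n)] with [u (y n) = 1] and
   [size (s n) = n].  If [y n] tends to [y] along an ultrafilter, on which the
   length-[k] prefix of [s n] is eventually a fixed word [t], then [f_t y] is at
   distance at most [r k] from [x]; hence [x] adheres to the orbit of [y]. *)
Lemma limit_orbit x : 0 < v x ->
  exists2 y, u y = 1 & closure (orbit_of f y) x.
Proof.
move=> vx; have [j0 _] := rA.2.
(* One [r n] leads from [x] to a point f_s x0 of the iterate, the other from there to f_s y by
   contraction. *)
have /choice[p pP] n : exists p : seq I * X,
    [/\ size p.1 = n, u p.2 = 1 & mdist x (fw p.1 p.2) <= r n + r n].
  have [q vq xq] := approx_limV n vx.
  have [s [x0 [sn fx0 ux0 _]]] := iter_attained fC rA uF (lt_le_trans vx vq).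
  have [w [y [wy wx uy]]] := FSs_orbit uS ux0.
  exists (s, y); split=> //=; apply: le_trans (metric_triangle x q _) _.
  rewrite lerD// -fx0 -sn; apply: contract_word wx wy _.
  by apply: (LP [::]); [exact: pos_level0|exact: level1].
have [G [GU ooG]] := free_ultrafilter.
have fx : (fun n => fw (p n).1 (p n).2) @ G --> x.
  apply: (@mdist0_cvg _ _ _ _ _ _ (fun n => r n + r n)).
    by move=> V; rewrite -(addr0 0) => /(cvgD r_cvg0 r_cvg0)/ooG.
  by apply: nearW => n; have [] := pP n.
have [|y uy py] := FXs_ultra_cvg (z := fun n => (p n).2) GU uF (@ltr01 R).
  by apply: nearW => n; have [_ -> _] := pP n.
exists y; first by apply/eqP; rewrite eq_le uy FXs_le1.
have prefix k : exists t, mdist x (fw t y) <= r k.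
  (* There are finitely many words of length [k]; the default letter [j0] of [nth] is out of play
     once [n >= k]. *)
  have [c cP] := @ultra_finite _ (k.-tuple I) G
    (fun n => [tuple of mkseq (nth j0 (p n).1) k]) GU.
  have kG : \forall n \near G, (k <= n)%N by apply: ooG; exact: nbhs_infty_ge.
  exists c; apply: mdist_limit_le fx
    (cvg_comp _ _ py (word_map_continuous fC (s := c) (x := y))) _.
  apply: filterS2 cP kG => n cn kn.
  have [sn un _] := pP n.
  have sE : (p n).1 = c ++ drop k (p n).1.
    by rewrite -cn /= /mkseq map_nth_iota0 ?sn// cat_take_drop.
  have -> : r k = r (size c) by rewrite size_tuple.
  rewrite sE word_map_cat metric_sym.
  apply: (contract_word (w := (p n).2)).
  - exact: closure_orbit_self.
  - exact/closure_orbit_word/closure_orbit_self.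
  - by apply: LP; exact: level1.
move=> V /nbhs_ballP[e /= e0]; rewrite ballEmdist => eV.
have [k rk] := filter_ex (near_lt0 r_cvg0 e0).
have [t xt] := prefix k; exists (fw t y); split; first exact: orbit_of_word.
by apply: eV; exact: le_lt_trans rk.
Qed.

Lemma limit_FSs : FSs f v.
Proof.
split; last exact: limF.2.
split=> [|x /limit_orbit[y uy yx]]; first exact: limF.1.
(* The orbit of [y] serves for [x]. Its points f_j^k y have grade 1 in the iterate [k], so their
   limit [q] has grade 1 in [v] and adheres to the same orbit. *)
have [j j1] := rA.2; have [G [GU ooG]] := free_ultrafilter.
have [|q yq vq] := fuzzy_limit_cvg cX vF r_cvg0 r_ge0 fuzzy_approx_iterV
  (x := fun k => fw (nseq k j) y) GU ooG (@ltr01 R).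
  by apply: nearW => k; rewrite /v_ iter_nseq_eq1.
exists y, q; split=> //; last by apply/eqP; rewrite eq_le vq FXs_le1.
apply: (closed_cvg _ (@closed_closure _ _) _ _ yq).
by apply: nearW => k; apply: subset_closure; exact: orbit_of_word.
Qed.

Lemma iter_cvg_limit : dinfty (iter n Z u) v @[n --> \oo] --> 0.
Proof.
apply: (squeeze_cvgr _ (cvg_cst 0) r_cvg0); apply: nearW => n.
rewrite dinfty_ge0/=; apply: fuzzy_approx_dinfty.
- by have [[]] := vF n.
- by have [[]] := limF.
- exact: approx_lim.
- exact: approx_limV.
Qed.

Lemma iter_cvg_fixpoint : exists v, [/\ FSs f v, Z v = v &
  dinfty (iter n Z u) v @[n --> \oo] --> 0].
Proof.
exists v; split; [exact: limit_FSs|exact: hutchinson_barnsley_limit|].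
exact: iter_cvg_limit.
Qed.

End picard.

Theorem theorem3p1 (R : realType) (X : metricType R) (I : finType)
    (f : I -> X -> X) (rho : I -> R -> R) :
  orbital_fuzzy_ifs f rho ->
  weakly_Picard (FSs f) dinfty (hutchinson_barnsley f rho).
Proof.
move=> [[cX _ fC [C C01 fK]] rA]; split=> u uS.
  exact: hutchinson_barnsley_FSs.
have [L L0 LP] := orbit_bounded fC C01 fK (FXs_compact_level0 (FSs_FXs uS)).
exact: (iter_cvg_fixpoint cX fC rA C01 fK uS L0 LP).
Qed.
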